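(* Let $f:\mathbb{R}^d\to\mathbb{R}$ be convex and differentiable with $L_f$-Lipschitz continuous gradient ($L_f>0$), let $g:\mathbb{R}^r\to\mathbb{R}$ be convex and Lipschitz continuous, and let $B\in\mathbb{R}^{r\times d}$ be nonzero. Let $\lambda$ satisfy $0<\lambda\le \frac{1}{\rho_{\max}(BB^T)}$, and let $(\theta_k)_{k\ge1}\subset(0,1]$ and $(\gamma_k)_{k\ge 1}$ be sequences such that, for all $k\ge 1$, $$0<\gamma_k\le \frac1{L_f},\qquad \frac{\gamma_{k+1}}{\gamma_k}\le\frac{\theta_{k+1}^2}{\theta_k^2(1-\theta_{k+1})},\qquad \frac{\gamma_k}{\gamma_{k+1}}\le\frac{1}{1-\theta_{k+1}},$$ (where $\theta_{k+1}<1$), the sequence $\frac{\gamma_k^2}{\theta_k^2}$ is increasing in $k$ and uniformly bounded, and $\theta_1=1$. Let $(x_k,y_k,x_k^{\rm ag},y_k^{\rm ag})_{k\ge1}$ be generated by the APDFP algorithm with these parameters from arbitrary $x_1=x_1^{\rm ag}\in\mathbb{R}^d$, $y_1=y_1^{\rm ag}\in\mathbb{R}^r$. Assume the min-max problem $\min_{x\in\mathbb{R}^d}\max_{y\in Y} f(x)+\langle Bx,y\rangle-g^*(y)$ has a saddle point, and let $B_1\subset\mathbb{R}^d$, $B_2\subset Y$ be bounded sets such that $B_1\times B_2$ contains a saddle point. Then there are finite constants $\Omega_1\ge 0$ (related to $B_1$) and $\Omega_2\ge 0$ (related to $B_2$), neither depending on $k$, such that for every $k\ge1$ $$\mathcal{G}_{B_1\times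 B_2}(x_{k+1}^{\rm ag},y_{k+1}^{\rm ag})\le\frac{\theta_k^2}{2\gamma_k}\,\Omega_1+\frac{\gamma_k}{2}\,\frac{\rho_{\max}(I-\lambda BB^T)}{\lambda}\,\Omega_2 .$$
   Context: $\rho_{\max}(\cdot)$ denotes the largest eigenvalue of a symmetric matrix. $g^*$ is the convex conjugate of $g$ and $Y=\{y\in\mathbb{R}^r: g^*(y)<+\infty\}$ its domain. For $\gamma>0$ and a proper convex l.s.c. function $h$, $\mathrm{Prox}_{\gamma h}(s)=\arg\min_{y}\{\gamma h(y)+\frac12\|y-s\|_2^2\}$. APDFP algorithm: given $\lambda>0$, $\gamma_k>0$, $\theta_k\in(0,1]$, and $x_1=x_1^{\rm ag}$, $y_1=y_1^{\rm ag}$, for $k=1,2,\dots$ set $$\begin{aligned} x_k^{\rm md}&=(1-\theta_k)x_k^{\rm ag}+\theta_kx_k,\\ \overline{x}_k&=x_k-\tfrac{\gamma_k}{\theta_k}\nabla f(x_k^{\rm md})-\tfrac{\gamma_k}{\theta_k}B^Ty_k,\\ y_{k+1}&=\mathrm{Prox}_{\frac{\lambda\theta_k}{\gamma_k}g^*}\!\left(\tfrac{\lambda\theta_k}{\gamma_k}B\overline{x}_k+y_k\right),\\ x_{k+1}&=x_k-\tfrac{\gamma_k}{\theta_k}\nabla f(x_k^{\rm md})-\tfrac{\gamma_k}{\theta_k}B^Ty_{k+1},\\ x_{k+1}^{\rm ag}&=(1-\theta_k)x_k^{\rm ag}+\theta_kx_{k+1},\\ y_{k+1}^{\rm ag}&=(1-\theta_k)y_k^{\rm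 ag}+\theta_ky_{k+1}. \end{aligned}$$ For $\tilde z=(\tilde x,\tilde y)$ and $z=(x,y)$ in $\mathbb{R}^d\times Y$, $$Q(\tilde z,z)=[f(\tilde x)+\langle B\tilde x,y\rangle-g^*(y)]-[f(x)+\langle Bx,\tilde y\rangle-g^*(\tilde y)].$$ The partial primal-dual gap is $\mathcal{G}_{B_1\times B_2}(\tilde x,\tilde y)=\max_{z\in B_1\times B_2}Q((\tilde x,\tilde y),z)$, with $\max$ understood as supremum. A saddle point is a point $\hat z=(\hat x,\hat y)\in\mathbb{R}^d\times Y$ with $Q(\hat z,z)\le 0$ for all $z\in\mathbb{R}^d\times Y$ (equivalently $f(\hat x)+\langle B\hat x,y\rangle-g^*(y)\le f(\hat x)+\langle B\hat x,\hat y\rangle-g^*(\hat y)\le f(x)+\langle Bx,\hat y\rangle-g^*(\hat y)$ for all $x\in\mathbb{R}^d,y\in Y$). *)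

(* Defs.v *)
From HB Require Import structures.
From mathcomp Require Import all_boot all_order all_algebra.
From mathcomp Require Import all_classical all_reals all_analysis.

Set Implicit Arguments.
Unset Strict Implicit.
Unset Printing Implicit Defensive.

Import Order.TTheory GRing.Theory Num.Theory.
Import numFieldNormedType.Exports.

Local Open Scope classical_set_scope.
Local Open Scope ring_scope.

Definition dot (R : realType) (n : nat) (u v : 'cV[R]_n) : R :=
  \sum_i u i 0 * v i 0.

(* The library norm on ['cV[R]_n] is the sup norm, hence a separate name. *)
Definition norm2 (R : realType) (n : nat) (u : 'cV[R]_n) : R :=
  Num.sqrt (dot u u).

Definition gradient (R : realType) (n : nat) (f : 'cV[R]_n -> R)
    (x : 'cV[R]_n) : 'cV[R]_n :=
  \col_i 'D_(delta_mx i 0) f x.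

(* Intended for symmetric [A] with [0 < n]: the set of eigenvalues is then
   finite and nonempty, so that the supremum is attained. *)
Definition rho_max (R : realType) (n : nat) (A : 'M[R]_n) : R :=
  sup [set a : R | eigenvalue A a].

Definition conjugate (R : realType) (n : nat) (g : 'cV[R]_n -> R)
    (y : 'cV[R]_n) : \bar R :=
  ereal_sup [set (dot u y - g u)%:E | u in setT].

Definition edom (R : realType) (n : nat) (h : 'cV[R]_n -> \bar R) :
    set 'cV[R]_n :=
  [set y | (h y < +oo)%E].

(* The set of minimizers; it is a singleton when [h] is proper, convex and
   lower semicontinuous and [0 < gamma]. *)
Definition Prox (R : realType) (n : nat) (gamma : R) (h : 'cV[R]_n -> \bar R)
    (s : 'cV[R]_n) : set 'cV[R]_n :=
  let obj y := (gamma%:E * h y + (2^-1 * norm2 (y - s) ^+ 2)%:E)%E in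
  [set y | forall z, (obj y <= obj z)%E].

(* Indices start at 1; entries of index 0 are unconstrained and unused. *)
Definition APDFP (R : realType) (d r : nat) (f : 'cV[R]_d -> R)
    (g : 'cV[R]_r -> R) (B : 'M[R]_(r, d)) (lambda : R)
    (theta gamma : nat -> R) (x xag : nat -> 'cV[R]_d)
    (y yag : nat -> 'cV[R]_r) : Prop :=
  [/\ xag 1%N = x 1%N, yag 1%N = y 1%N &
    forall k : nat, (1 <= k)%N ->
      let xmd := (1 - theta k) *: xag k + theta k *: x k in
      let xbar := x k - (gamma k / theta k) *: gradient f xmd
                      - (gamma k / theta k) *: (B^T *m y k) in
      [/\ y k.+1 \in Prox (lambda * theta k / gamma k) (conjugate g)
                       ((lambda * theta k / gamma k) *: (B *m xbar) + y k),
          x k.+1 = x k - (gamma k / theta k) *: gradient f xmd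
                       - (gamma k / theta k) *: (B^T *m y k.+1),
          xag k.+1 = (1 - theta k) *: xag k + theta k *: x k.+1 &
          yag k.+1 = (1 - theta k) *: yag k + theta k *: y k.+1]].

(* Extended-real valued, so that no junk value is used off the domain of the
   conjugate. *)
Definition Q (R : realType) (d r : nat) (f : 'cV[R]_d -> R)
    (g : 'cV[R]_r -> R) (B : 'M[R]_(r, d))
    (zt z : 'cV[R]_d * 'cV[R]_r) : \bar R :=
  (((f zt.1 + dot (B *m zt.1) z.2)%:E - conjugate g z.2)
   - ((f z.1 + dot (B *m z.1) zt.2)%:E - conjugate g zt.2))%E.

Definition partial_gap (R : realType) (d r : nat) (f : 'cV[R]_d -> R)
    (g : 'cV[R]_r -> R) (B : 'M[R]_(r, d)) (B1 : set 'cV[R]_d)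
    (B2 : set 'cV[R]_r) (xt : 'cV[R]_d) (yt : 'cV[R]_r) : \bar R :=
  ereal_sup [set Q f g B (xt, yt) z | z in B1 `*` B2].

Definition saddle_point (R : realType) (d r : nat) (f : 'cV[R]_d -> R)
    (g : 'cV[R]_r -> R) (B : 'M[R]_(r, d)) (zh : 'cV[R]_d * 'cV[R]_r) : Prop :=
  edom (conjugate g) zh.2 /\
  forall z : 'cV[R]_d * 'cV[R]_r,
    edom (conjugate g) z.2 -> (Q f g B zh z <= 0)%E.

(* Main.v *)
Require Import Defs.
From HB Require Import structures.
From mathcomp Require Import all_boot all_order all_algebra.
From mathcomp Require Import all_classical all_reals all_analysis.
From mathcomp Require Import ring lra.

Set Implicit Arguments.
Unset Strict Implicit.
Unset Printing Implicit Defensive.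

Import Order.TTheory GRing.Theory Num.Theory.
Import numFieldNormedType.Exports.

Local Open Scope classical_set_scope.
Local Open Scope ring_scope.

(** The iteration is an accelerated primal-dual method, and the bound comes from
one energy inequality.  Substituting the definition of the auxiliary point
[xbar] into the proximal step turns it into a proximal step based at the new
primal point [x k.+1], but measured in the semi-metric of
[M = I - lambda B B^T].  This [M] is positive semidefinite because [lambda] is
at most [1 / rho_max (B B^T)] ([quad_le_rho_max]).  Hence the dual step
satisfies a variational inequality whose error telescopes in the [M]-seminorm
([dual_step]), while the primal step is a gradient step with Nesterov
extrapolation ([accelerated_gradient_step]).  The bilinear terms of the two
estimates cancel, and for every [z = (u, v)] the gap [q] at the averaged
iterates satisfies, with [a = theta ^ 2 / (2 gamma)] and
[b = gamma / (2 lambda)],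
[[
  q k.+1 <= (1 - theta k) q k + a k (X k - X k.+1) + b k (Y k - Y k.+1),
]]
where [X k] is the squared distance from [x k] to [u] and [Y k] the squared
[M]-seminorm of [y k - v].

The two ratio conditions on the step sizes are exactly
[(1 - theta k.+1) a k <= a k.+1] and [(1 - theta k.+1) b k <= b k.+1]; with
[theta 1 = 1] they allow the recursion to be summed, so that [q n.+1] is at most
[a n] times a bound of [X] plus [b n] times a bound of [Y]
([weighted_telescope]).

It remains to bound [X] and [Y] uniformly in [k].  The domain of the conjugate
of a Lipschitz function is bounded ([edom_conjugate_bounded]), which handles
[Y].  For [X], take for [z] a saddle point, so that the gap is nonnegative.  Let
[t = b / a = gamma ^ 2 / (lambda theta ^ 2)], which is nondecreasing and
bounded, and let [D] bound [Y].  As [Y - D <= 0] and [t] grows, the potential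
[S k = X k + t k (Y k - D)] satisfies the same recursion with the single weight
[a], and nonnegativity of the gap then forces [S k <= S 1]
([potential_le_initial]); this bounds [X k] by [S 1 + (sup t) D]. *)

(** * The Euclidean inner product *)

Section Dot.
Context {R : realType}.
Implicit Types n m : nat.

Lemma dotE n (u v : 'cV[R]_n) : dot u v = (u^T *m v) 0 0.
Proof. by rewrite mxE; apply: eq_bigr => i _; rewrite mxE. Qed.

Lemma dotC n (u v : 'cV[R]_n) : dot u v = dot v u.
Proof. by apply: eq_bigr => i _; rewrite mulrC. Qed.

Lemma dotDl n (u v w : 'cV[R]_n) : dot (u + v) w = dot u w + dot v w.
Proof. by rewrite -big_split; apply: eq_bigr => i _; rewrite mxE mulrDl. Qed.

Lemma dotZl n a (u v : 'cV[R]_n) : dot (a *: u) v = a * dot u v.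
Proof. by rewrite mulr_sumr; apply: eq_bigr => i _; rewrite mxE mulrA. Qed.

Lemma dotNl n (u v : 'cV[R]_n) : dot (- u) v = - dot u v.
Proof. by rewrite -scaleN1r dotZl mulN1r. Qed.

Lemma dotDr n (u v w : 'cV[R]_n) : dot w (u + v) = dot w u + dot w v.
Proof. by rewrite dotC dotDl !(dotC w). Qed.

Lemma dotZr n a (u v : 'cV[R]_n) : dot v (a *: u) = a * dot v u.
Proof. by rewrite dotC dotZl (dotC v). Qed.

Lemma dotNr n (u v : 'cV[R]_n) : dot v (- u) = - dot v u.
Proof. by rewrite dotC dotNl (dotC v). Qed.

(** Expands inner products of combinations into inner products of atoms, leaving
identities that linear arithmetic closes up to [dotC]. *)
Definition dotLR := (dotDl, dotDr, dotNl, dotNr, dotZl, dotZr).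

Lemma dot0l n (u : 'cV[R]_n) : dot 0 u = 0.
Proof. by rewrite -(scale0r 0) dotZl mul0r. Qed.

Lemma dot_mulmxl m n (A : 'M[R]_(m, n)) u v : dot (A *m u) v = dot u (A^T *m v).
Proof. by rewrite !dotE trmx_mul mulmxA. Qed.

Lemma dot_sqr_ge0 n (u : 'cV[R]_n) : 0 <= dot u u.
Proof. by apply: sumr_ge0 => i _; rewrite -expr2 sqr_ge0. Qed.

Lemma dot_sqr_gt0 n (u : 'cV[R]_n) : u != 0 -> 0 < dot u u.
Proof.
move=> u0; rewrite lt_def dot_sqr_ge0 andbT; apply: contra u0.
rewrite psumr_eq0 => [/allP u0|i _]; last by rewrite -expr2 sqr_ge0.
apply/eqP/matrixP => i j; rewrite ord1 mxE; apply/eqP.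
by have /implyP := u0 i (mem_index_enum i); rewrite mulf_eq0 orbb; apply.
Qed.

Lemma norm2_sqr n (u : 'cV[R]_n) : norm2 u ^+ 2 = dot u u.
Proof. by rewrite sqr_sqrtr ?dot_sqr_ge0. Qed.

Lemma norm2_ge0 n (u : 'cV[R]_n) : 0 <= norm2 u.
Proof. exact: sqrtr_ge0. Qed.

(** Expand the squared norm of [(v.v) u - (u.v) v], a vector orthogonal to
[v]. *)
Lemma cauchy_schwarz n (u v : 'cV[R]_n) : dot u v <= norm2 u * norm2 v.
Proof.
have [->|v0] := eqVneq v 0.
  by rewrite dotC dot0l mulr_ge0 ?norm2_ge0.
have := dot_sqr_ge0 (dot v v *: u - dot u v *: v).
rewrite !dotLR (dotC v u).
have vv := dot_sqr_gt0 v0.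
move=> h; have {}h : 0 <= dot v v * (dot u u * dot v v - dot u v ^+ 2) by lra.
rewrite pmulr_rge0 // subr_ge0 in h.
rewrite -sqrtrM ?dot_sqr_ge0 // (le_trans (ler_norm _)) //.
by rewrite -sqrtr_sqr ler_wsqrtr.
Qed.

Lemma dot_sqrB_le n (u v w : 'cV[R]_n) :
  dot (u - w) (u - w) <= 2 * dot (u - v) (u - v) + 2 * dot (v - w) (v - w).
Proof.
have := dot_sqr_ge0 (u - v - (v - w)).
by rewrite !dotLR (dotC v u) (dotC w u) (dotC w v); lra.
Qed.

(** What makes the energy estimates telescope: a step [u - v] tested against
[v - w] is the decrease of the squared distance to [w], up to a square. *)
Lemma dot_three_point n (u v w : 'cV[R]_n) :
  2 * dot (u - v) (v - w) =
  dot (u - w) (u - w) - dot (v - w) (v - w) - dot (u - v) (u - v).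
Proof. by rewrite !dotLR (dotC v u) (dotC w u) (dotC w v); ring. Qed.

(** Boundedness of sets refers to the sup norm; this transfers it to the
Euclidean norm. *)
Lemma dot_sqr_le_normr n (u : 'cV[R]_n) : dot u u <= n%:R * `|u| ^+ 2.
Proof.
rewrite -[n in n%:R]card_ord mulr_natl -sumr_const; apply: ler_sum => i _.
rewrite -expr2 -real_normK ?num_real // ler_sqr ?nnegrE ?normr_ge0 //.
rewrite [leRHS]/Num.Def.normr /= mx_normrE.
exact: (le_bigmax _ (fun ij => `|u ij.1 ij.2|) (i, 0)).
Qed.

End Dot.

(** First-order optimality conditions are extracted with this lemma, from a
comparison along a segment. *)
Lemma slope_le0_of_quadratic (R : realType) (a b : R) :
  (forall t, 0 < t <= 1 -> a * t + b * t ^+ 2 <= 0) -> a <= 0.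
Proof.
move=> h; rewrite leNgt; apply/negP => a0.
(* At [t = a / (2 (a + |b|))] the quadratic term is at most half the linear
   one. *)
have b0 : 0 < a + `|b| by rewrite ltr_wpDr.
have t1 : 0 < a / (a + `|b|) / 2 by rewrite !divr_gt0.
have b1 : a / (a + `|b|) <= 1 by rewrite ler_pdivrMr // mul1r lerDl.
have := h (a / (a + `|b|) / 2); rewrite t1 /= => /(_ ltac:(lra)).
set t := _ / 2 in t1 *; rewrite (_ : _ + _ = (a + b * t) * t); last by ring.
move=> le0.
have : 0 < (a + b * t) * t.
  rewrite mulr_gt0 //.
  have : `|b| * t <= a / 2.
    rewrite /t mulrA ler_pM2r ?invr_gt0 // mulrA ler_pdivrMr //.
    by have := normr_ge0 b; nra.
  have := ler_norm (- b); rewrite normrN => hb hbt.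
  have : - b * t <= `|b| * t by rewrite ler_pM2r.
  lra.
by rewrite ltNge le0.
Qed.

(** * The largest eigenvalue of a symmetric matrix *)

Section Spectrum.
Context {R : realType}.

Lemma continuous_quad n (A : 'M[R]_n) :
  continuous (fun u : 'rV[R]_n => dot (A *m u^T) u^T).
Proof.
have cont_sum (F : 'I_n -> 'rV[R]_n -> R) : (forall i, continuous (F i)) ->
    continuous (fun u => \sum_i F i u).
  by move=> cF; apply: continuous_big => //; exact: add_continuous.
have -> : (fun u : 'rV[R]_n => dot (A *m u^T) u^T) =
    (fun u => \sum_i (\sum_j A i j * u 0 j) * u 0 i).
  apply/funext => u; apply: eq_bigr => i _; rewrite !mxE; congr (_ * _).
  by apply: eq_bigr => j _; rewrite mxE.
have cont_mul (F G : 'rV[R]_n -> R) : continuous F -> continuous G ->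
    continuous (fun u => F u * G u).
  by move=> cF cG u; exact: (continuousM (cF u) (cG u)).
have cont_coord j : continuous (fun u : 'rV[R]_n => u 0 j : R).
  exact: coord_continuous.
apply: (cont_sum (fun i u => _)) => i; apply: (cont_mul (fun u => _)) => //.
apply: (cont_sum (fun j u => A i j * u 0 j)) => j.
by apply: (cont_mul (fun=> A i j)) => //; exact: cst_continuous.
Qed.

Lemma compact_sphere n : compact [set u : 'rV[R]_n | dot u^T u^T = 1].
Proof.
apply: bounded_closed_compact; last first.
  apply: (@preimage_closed _ _ (fun u : 'rV[R]_n => dot u^T u^T) [set 1]).
    move=> u _; have := @continuous_quad n 1%:M u.
    by under eq_fun do rewrite mul1mx.
  exact: closed_eq.
exists 1; split => [|M M1 u /= u1]; first exact: num_real.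
rewrite (le_trans _ (ltW M1)) // [leLHS]/Num.Def.normr /= mx_normrE.
rewrite bigmax_le // => -[i j] _ /=.
rewrite -(@ler_sqr _ _ 1) ?nnegrE // real_normK ?num_real // expr1n -u1 ord1.
rewrite /dot (bigD1 j) //= !mxE -expr2 lerDl.
by apply: sumr_ge0 => k _; rewrite -expr2 sqr_ge0.
Qed.

(** The maximum [m] of the quadratic form on the unit sphere is attained, by
compactness, and a maximizer is an eigenvector for [m] by first-order
optimality.  All eigenvalues are values of the form on the sphere, so [m] is
[rho_max A]. *)
Lemma quad_le_rho_max n (A : 'M[R]_n) (u : 'cV[R]_n) : A^T = A ->
  dot (A *m u) u <= rho_max A * dot u u.
Proof.
move=> symA.
have [->|u0] := eqVneq u 0; first by rewrite mulmx0 !dot0l mulr0.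
have unit w : w != 0 -> dot ((norm2 w)^-1 *: w) ((norm2 w)^-1 *: w) = 1.
  move=> /dot_sqr_gt0 w0; rewrite dotZl dotZr mulrA -expr2 exprVn norm2_sqr.
  by rewrite mulVf // gt_eqF.
have [|c] := compact_EVT_max _ (@compact_sphere n)
    (continuous_subspaceT (@continuous_quad n A)).
  by exists ((norm2 u)^-1 *: u)^T; rewrite /= trmxK unit.
rewrite inE /= => c1 maxc.
set m := dot (A *m c^T) c^T in maxc.
have quad_le w : dot (A *m w) w <= m * dot w w.
  have [->|w0] := eqVneq w 0; first by rewrite mulmx0 !dot0l mulr0.
  have := maxc ((norm2 w)^-1 *: w)^T.
  rewrite inE /= trmxK unit // => /(_ erefl).
  rewrite -scalemxAr dotZl dotZr mulrA -expr2 exprVn norm2_sqr mulrC.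
  by rewrite ler_pdivrMr // dot_sqr_gt0.
(* First-order optimality of [c], tested against the residual [w]. *)
have eigc : A *m c^T = m *: c^T.
  apply/eqP; rewrite -subr_eq0; apply: contraT => /dot_sqr_gt0.
  move Dw: (_ - _) => w; suff : 2 * dot w w <= 0 by lra.
  apply: (@slope_le0_of_quadratic _ _ (dot (A *m w) w - m * dot w w)) => t _.
  have := quad_le (c^T + t *: w).
  have -> : 2 * dot w w = 2 * (dot (A *m c^T) w - m * dot c^T w).
    by rewrite -{1}Dw !dotLR.
  rewrite mulmxDr -scalemxAr !dotLR -/m c1.
  by rewrite (dot_mulmxl A w c^T) symA (dotC w (A *m _)) (dotC w c^T); lra.
have eigm : eigenvalue A m.
  apply/eigenvalueP; exists c.
    by apply: trmx_inj; rewrite trmx_mul symA eigc linearZ.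
  by apply: contra_eqN c1 => /eqP ->; rewrite trmx0 dot0l eq_sym oner_eq0.
have le_m a : eigenvalue A a -> a <= m.
  move=> /eigenvalueP[v vA v0].
  have v0' : v^T != 0.
    by apply: contra_neq v0 => /(congr1 trmx); rewrite trmxK trmx0.
  have := quad_le v^T; rewrite -{1}symA -trmx_mul vA linearZ dotZl.
  by rewrite ler_pM2r // dot_sqr_gt0.
apply: le_trans (quad_le u) _; apply: ler_wpM2r; first exact: dot_sqr_ge0.
by apply: ub_le_sup => //; exists m => a; exact: le_m.
Qed.

End Spectrum.

(** * Convex functions with Lipschitz gradient *)

Lemma convex_function_segment (R : realType) (d : nat) (h : 'cV[R]_d -> R) :
  @convex_function R 'cV[R]_d setT h ->
  forall t u v, 0 <= t <= 1 ->
    h ((1 - t) *: u + t *: v) <= (1 - t) * h u + t * h v.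
Proof.
move=> h_convex t u v /andP[t0 t1].
have := h_convex (Itv01 t0 t1) v u (mem_set I) (mem_set I).
by rewrite addrC [leRHS]addrC.
Qed.

Section Smooth.
Context {R : realType} {d : nat} (f : 'cV[R]_d -> R).
Context (f_diff : forall u, differentiable f u).

Lemma derive_gradient u v : 'D_v f u = dot (gradient f u) v.
Proof.
rewrite deriveE // [v in LHS]matrix_sum_delta linear_sum /=.
by apply: eq_bigr => i _; rewrite big_ord1 linearZ /= mxE deriveE // mulrC.
Qed.

Lemma is_derive_line (u v : 'cV[R]_d) (t : R) :
  is_derive t (1 : R) (fun s : R => f (u + s *: v))
    (dot (gradient f (u + t *: v)) v).
Proof.
have E : (fun h : R => h^-1 *: ((fun s : R => f (u + s *: v)) (h *: 1 + t)
                                - f (u + t *: v)))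
   = (fun h => h^-1 *: (f (h *: v + (u + t *: v)) - f (u + t *: v))).
  apply/funext => h; congr (_ *: (f _ - _)).
  by rewrite [h *: 1]mulr1 scalerDl addrCA.
have df : derivable f (u + t *: v) v by exact: diff_derivable.
apply: DeriveDef; first by rewrite /derivable E.
by rewrite -derive_gradient /derive E.
Qed.

Lemma convex_gradient_le u v :
  @convex_function R 'cV[R]_d setT f -> f u + dot (gradient f u) (v - u) <= f v.
Proof.
move=> f_convex; rewrite -lerBrDl -derive_gradient.
have /cvg_dnbhs_at_right dcvg : derivable f u (v - u) by exact: diff_derivable.
apply: (cvgr_to_le dcvg).
near=> t.
have t0 : 0 < t by near: t; exact: nbhs_right_gt.
have t1 : t <= 1 by near: t; apply: nbhs_right_le.
rewrite /= [_ *: _]mulrC ler_pdivrMr //.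
have -> : t *: (v - u) + u = (1 - t) *: u + t *: v.
  rewrite scalerBr scalerBl scale1r addrC -addrA; congr (_ + _).
  by rewrite addrC.
have := convex_function_segment f_convex u v (t := t).
by rewrite (ltW t0) t1 => /(_ isT); lra.
Unshelve. all: by end_near.
Qed.

(** By the mean value theorem on the segment from [u] to [v]: after subtracting
its linear part and the quadratic term, [f] has nonpositive derivative there,
by Cauchy-Schwarz and the Lipschitz bound on the gradient. *)
Lemma lipschitz_gradient_upper_bound (L : R) u v :
  (forall u v, norm2 (gradient f u - gradient f v) <= L * norm2 (u - v)) ->
  f v <= f u + dot (gradient f u) (v - u) + L / 2 * dot (v - u) (v - u).
Proof.
move=> f_lip; set w := v - u.
pose psi (t : R) := f (u + t *: w).
pose phi (t : R) := t * dot (gradient f u) w + L / 2 * dot w w * t ^+ 2.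
have dpsi (t : R) : is_derive t 1 (psi \- phi)
   (dot (gradient f (u + t *: w)) w - (dot (gradient f u) w + L * dot w w * t)).
  apply: is_deriveB; first exact: is_derive_line.
  apply: is_derive_eq.
  rewrite scaler0 add0r -scalerDl.
  by rewrite -![_ *: _]/(_ * _) mulr1; lra.
have [|c /itvP c01] :=
    @MVT_segment R (psi \- phi) _ 0 1 ler01 (fun t _ => dpsi t).
  by apply: derivable_within_continuous => t _; have [] := dpsi t.
rewrite /psi /phi /= scale0r scale1r addr0.
rewrite /w [u + _]addrC subrK -/w => psi1.
have : dot (gradient f (u + c *: w) - gradient f u) w <= L * dot w w * c.
  apply: le_trans (cauchy_schwarz _ _) _.
  apply: le_trans (ler_wpM2r (norm2_ge0 _) (f_lip _ _)) _.
  rewrite [u + _]addrC addrK {1}/norm2 dotZl dotZr mulrA -expr2.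
  rewrite sqrtrM ?sqr_ge0 // sqrtr_sqr ger0_norm ?c01 // -/(norm2 w).
  by rewrite -norm2_sqr expr2; lra.
by rewrite dotDl dotNl; lra.
Qed.

End Smooth.

(** * The conjugate and its proximal map *)

Section Conjugate.
Context {R : realType} {n : nat} (g : 'cV[R]_n -> R).
Local Notation h y := (fine (conjugate g y)).

Lemma conjugate_fin_num y : edom (conjugate g) y -> conjugate g y \is a fin_num.
Proof.
rewrite /edom /= fin_numElt => ->; rewrite andbT.
by apply: lt_le_trans (ltNyr _) (ereal_sup_ubound _); exists 0.
Qed.

Lemma fenchel_young u y : edom (conjugate g) y -> dot u y <= g u + h y.
Proof.
move=> /conjugate_fin_num yfin; rewrite -lerBlDl -lee_fin fineK //.
by apply: ereal_sup_ubound; exists u.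
Qed.

Lemma conjugate_convex t y z : edom (conjugate g) y -> edom (conjugate g) z ->
  0 <= t <= 1 ->
  edom (conjugate g) ((1 - t) *: y + t *: z) /\
  h ((1 - t) *: y + t *: z) <= (1 - t) * h y + t * h z.
Proof.
move=> ydom zdom /andP[t0 t1].
have le : (conjugate g ((1 - t) *: y + t *: z) <=
           ((1 - t) * h y + t * h z)%:E)%E.
  apply: ge_ereal_sup => _ [u _ <-]; rewrite lee_fin dotDr !dotZr.
  have := fenchel_young u ydom; have := fenchel_young u zdom.
  by nra.
have dom : edom (conjugate g) ((1 - t) *: y + t *: z).
  exact: le_lt_trans le (ltry _).
by split=> //; rewrite -lee_fin fineK ?conjugate_fin_num.
Qed.

(** In the Fenchel-Young inequality at [t y], the left side grows like
[t |y| ^ 2] and the right side at most like [t L |y|]; letting [t] grow gives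
[|y| <= L]. *)
Lemma edom_conjugate_bounded (L : R) y :
  (forall u v, `|g u - g v| <= L * norm2 (u - v)) ->
  edom (conjugate g) y -> dot y y <= L ^+ 2.
Proof.
move=> g_lip ydom.
have le : norm2 y ^+ 2 <= L * norm2 y.
  rewrite leNgt; apply/negP => gt0; rewrite -subr_gt0 in gt0.
  set e := _ - _ in gt0; pose t := (`|h y + g 0| + 1) / e.
  have t0 : 0 < t by rewrite divr_gt0 // ltr_wpDl.
  have fy := fenchel_young (t *: y) ydom; rewrite dotZl -norm2_sqr in fy.
  have := le_trans (ler_norm _) (g_lip (t *: y) 0).
  rewrite subr0 {1}/norm2 dotZl dotZr mulrA -expr2.
  rewrite sqrtrM ?sqr_ge0 // sqrtr_sqr ger0_norm ?(ltW t0) // -/(norm2 y).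
  move=> glip.
  have te : t * e = `|h y + g 0| + 1 by rewrite divfK ?gt_eqF.
  have := ler_norm (h y + g 0).
  by rewrite /e in te; nra.
rewrite -norm2_sqr.
have := sqr_ge0 (norm2 y - L); nra.
Qed.

(** The subgradient form of the proximal step, obtained by comparing the
minimizer [y] with the points of the segment from [y] to [z]. *)
Lemma prox_conjugate c s y z : 0 < c -> Prox c (conjugate g) s y ->
  edom (conjugate g) z ->
  edom (conjugate g) y /\ h y + c^-1 * dot (s - y) (z - y) <= h z.
Proof.
move=> c0 ymin zdom.
have ydom : edom (conjugate g) y.
  have := ymin z; rewrite -(fineK (conjugate_fin_num zdom)) -EFinM -EFinD.
  move=> /le_lt_trans /(_ (ltry _)); rewrite /edom /=.
  case: (conjugate g y) => [r _|/=|] //; first exact: ltry.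
  by rewrite mulry gtr0_sg // mul1e.
split=> //.
have min w : edom (conjugate g) w ->
    c * h y + 2^-1 * dot (y - s) (y - s)
    <= c * h w + 2^-1 * dot (w - s) (w - s).
  move=> wdom; have := ymin w.
  rewrite -(fineK (conjugate_fin_num wdom)) -(fineK (conjugate_fin_num ydom)).
  by rewrite -!EFinM -!EFinD lee_fin !norm2_sqr.
suff : c * h y + dot (s - y) (z - y) - c * h z <= 0.
  by move=> le0; rewrite -(ler_pM2l c0) mulrDr mulVKf ?gt_eqF //; lra.
apply: (@slope_le0_of_quadratic _ _ (- 2^-1 * dot (z - y) (z - y))).
move=> t /andP[t0 t1].
have [] := @conjugate_convex t y z ydom zdom; first by rewrite (ltW t0).
move=> /min + hconv.
have -> : (1 - t) *: y + t *: z - s = (y - s) + t *: (z - y).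
  rewrite scalerBl scale1r scalerBr addrAC -!addrA; congr (_ + _).
  by rewrite addrC addrA.
have -> : dot (s - y) (z - y) = - dot (y - s) (z - y) by rewrite -dotNl opprB.
move: (y - s) (z - y) => v w; rewrite !dotLR (dotC w v).
have := ler_wpM2l (ltW c0) hconv.
by lra.
Qed.

End Conjugate.

(** * One iteration *)

Section Steps.
Context {R : realType}.

(** The quadratic upper bound for [f] at the averaged point, whose distance to
[xmd] is [th (x1 - x0)], combined with the convexity lower bounds at [xa] and
[x] weighted by [1 - th] and [th].  The condition [ga <= 1 / L] makes the
square of [x1 - x0] left over by the three-point identity absorb the quadratic
term. *)
Lemma accelerated_gradient_step d (f : 'cV[R]_d -> R) (L ga th : R)
    (xa x0 x1 p x : 'cV[R]_d) :
  @convex_function R 'cV[R]_d setT f -> (forall u, differentiable f u) ->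
  (forall u v, norm2 (gradient f u - gradient f v) <= L * norm2 (u - v)) ->
  0 < L -> 0 < th <= 1 -> 0 < ga <= 1 / L ->
  x1 = x0 - (ga / th) *: gradient f ((1 - th) *: xa + th *: x0)
          - (ga / th) *: p ->
  f ((1 - th) *: xa + th *: x1) <= (1 - th) * f xa + th * f x
    - th * dot (x1 - x) p
    + th ^+ 2 / (2 * ga) * (dot (x0 - x) (x0 - x) - dot (x1 - x) (x1 - x)).
Proof.
move=> f_convex f_diff f_lip L0 /andP[th0 th1] /andP[ga0 gaL].
set xmd := (1 - th) *: xa + th *: x0; set G := gradient f xmd => x1E.
have := lipschitz_gradient_upper_bound f_diff xmd
  ((1 - th) *: xa + th *: x1) f_lip.
have -> : (1 - th) *: xa + th *: x1 - xmd = th *: (x1 - x0).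
  by rewrite /xmd opprD addrACA subrr add0r scalerBr.
have ca := convex_gradient_le f_diff xmd xa f_convex.
have cx := convex_gradient_le f_diff xmd x f_convex.
have c : f xmd + th * dot G (x - x0) <= (1 - th) * f xa + th * f x.
  have th1' : 0 <= 1 - th by lra.
  have := lerD (ler_wpM2l th1' ca) (ler_wpM2l (ltW th0) cx).
  apply: le_trans; rewrite -/G /xmd !dotLR; lra.
have GE : G = (th / ga) *: (x0 - x1) - p.
  have -> : x0 - x1 = (ga / th) *: (G + p).
    by rewrite x1E -addrA -opprD -scalerDr opprB addrC subrK.
  have -> : th / ga = (ga / th)^-1 by rewrite invf_div.
  by rewrite scalerA mulVf ?scale1r ?addrK // mulf_neq0 ?invr_eq0 ?gt_eqF.
rewrite -/G !dotZl !dotZr.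
have -> : x1 - x0 = - (x0 - x1) by rewrite opprB.
have tp := dot_three_point x0 x1 x.
move: c; have -> : x - x0 = - (x0 - x1) - (x1 - x).
  by rewrite -opprD addrA subrK opprB.
move: (x0 - x1) (x1 - x) (dot (x0 - x) (x0 - x)) tp GE => u v X0 tp GE c.
have Gv : th * dot G v =
    th ^+ 2 / (2 * ga) * (X0 - dot v v - dot u u) - th * dot v p.
  rewrite -tp GE dotDl dotZl dotNl (dotC p v); field.
  by rewrite gt_eqF.
rewrite !dotNl !dotNr opprK.
have : L / 2 * (th * (th * dot u u)) <= th ^+ 2 / (2 * ga) * dot u u.
  have -> : th ^+ 2 / (2 * ga) * dot u u = ga^-1 / 2 * (th * (th * dot u u)).
    by field; rewrite gt_eqF.
  rewrite ler_wpM2r ?mulr_ge0 ?dot_sqr_ge0 ?(ltW th0) // ler_pM2r ?invr_gt0 //.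
  by rewrite -[L]invrK lef_pV2 ?posrE ?invr_gt0 // -div1r.
move: c; rewrite dotDr !dotNr; lra.
Qed.

(** Since [x0 - a G - a B^T y0] is [x1 - a B^T (y0 - y1)] and [c a = la], the
residual of the proximal step is [c B x1 + M (y0 - y1)]: the explicit dual step
becomes an implicit one in the [M]-seminorm, and the three-point identity for
[M] applies. *)
Lemma dual_step d r (g : 'cV[R]_r -> R) (B : 'M[R]_(r, d)) (la a c : R)
    (x0 x1 G : 'cV[R]_d) (y0 y1 y : 'cV[R]_r)
    (M := 1%:M - la *: (B *m B^T)) (h := fun y => fine (conjugate g y)) :
  0 < la -> 0 < a -> c = la / a ->
  (forall u, 0 <= dot (M *m u) u) ->
  y1 \in Prox c (conjugate g)
    (c *: (B *m (x0 - a *: G - a *: (B^T *m y0))) + y0) ->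
  x1 = x0 - a *: G - a *: (B^T *m y1) ->
  edom (conjugate g) y ->
  h y1 + dot (B *m x1) (y - y1) <=
  h y + a / (2 * la) * (dot (M *m (y0 - y)) (y0 - y)
                        - dot (M *m (y1 - y)) (y1 - y)).
Proof.
move=> la0 a0 cE Mpsd /set_mem prox x1E ydom.
have c0 : 0 < c by rewrite cE divr_gt0.
have [_] := prox_conjugate c0 prox ydom.
have -> : c *: (B *m (x0 - a *: G - a *: (B^T *m y0))) + y0 - y1 =
    c *: (B *m x1) + M *m (y0 - y1).
  have -> : x0 - a *: G - a *: (B^T *m y0) = x1 - a *: (B^T *m (y0 - y1)).
    by rewrite x1E mulmxBr scalerBr opprB addrA subrK.
  rewrite mulmxBr -scalemxAr scalerBr scalerA mulmxA.
  have -> : c * a = la by rewrite cE divfK ?gt_eqF.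
  by rewrite /M mulmxBl mul1mx -scalemxAl -[LHS]addrA addrAC -[LHS]addrA.
have Msym u v : dot (M *m u) v = dot (M *m v) u.
  rewrite dot_mulmxl dotC; congr (dot (_ *m _) _).
  by rewrite /M linearB /= linearZ /= trmx1 trmx_mul trmxK.
have := Mpsd (y0 - y1).
have -> : y0 - y = (y0 - y1) - (y - y1) by rewrite opprB addrA subrK.
have -> : y1 - y = - (y - y1) by rewrite opprB.
move: (y0 - y1) (y - y1) => u v Mu.
rewrite !mulmxBr !mulmxN !dotLR (Msym v u) -/(h y) -/(h y1).
have -> : c^-1 * (c * dot (B *m x1) v + dot (M *m u) v) =
    dot (B *m x1) v + a / la * dot (M *m u) v.
  by rewrite cE; field; rewrite !gt_eqF.
have -> : a / (2 * la) = a / la / 2 by field; rewrite gt_eqF.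
have : 0 <= a / la * dot (M *m u) u by rewrite mulr_ge0 // divr_ge0 // ltW.
lra.
Qed.

End Steps.

(** * Summation of the energy inequality *)

Section Summation.
Context {R : realType}.

(** Abel summation, done by induction: as [MX - X] is nonnegative, the condition
on [a] allows [(1 - th k.+1) * a k * (MX - X k.+1)] to be replaced by
[a k.+1 * (MX - X k.+1)], whose [X k.+1] cancels; the same holds for [b] and
[Y].  The value [th 1 = 1] erases [q 1], whatever it is. *)
Lemma weighted_telescope (th a b X Y q : nat -> R) (MX MY : R) (n : nat) :
  (forall k, (1 <= k)%N -> 0 < th k <= 1) -> th 1%N = 1 ->
  (forall k, (1 <= k)%N -> (1 - th k.+1) * a k <= a k.+1) ->
  (forall k, (1 <= k)%N -> (1 - th k.+1) * b k <= b k.+1) ->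
  (forall k, (1 <= k)%N -> q k.+1 <= (1 - th k) * q k
     + a k * (X k - X k.+1) + b k * (Y k - Y k.+1)) ->
  (forall k, (1 <= k)%N -> 0 <= a k) -> (forall k, (1 <= k)%N -> 0 <= b k) ->
  (forall k, (1 <= k <= n)%N -> X k <= MX) ->
  (forall k, (1 <= k <= n)%N -> Y k <= MY) -> (1 <= n)%N ->
  q n.+1 <= a n * (MX - X n.+1) + b n * (MY - Y n.+1).
Proof.
move=> th01 th1 ha hb step a0 b0; elim: n => // -[_|n IH] hX hY _.
  have := step 1%N isT; rewrite th1 subrr mul0r add0r.
  have := ler_wpM2l (a0 1%N isT) (hX 1%N isT).
  have := ler_wpM2l (b0 1%N isT) (hY 1%N isT); lra.
have le k : (1 <= k <= n.+1 -> 1 <= k <= n.+2)%N by case/andP=> -> /leqW ->.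
have {}IH := IH (fun k hk => hX k (le k hk)) (fun k hk => hY k (le k hk)) isT.
have th0 : 0 <= 1 - th n.+2 by have /andP[_] := th01 n.+2 isT; lra.
apply: le_trans (step n.+2 isT) _; have := ler_wpM2l th0 IH.
have : 0 <= MX - X n.+2 by rewrite subr_ge0 hX //= leqnn.
move=> /ler_wpM2r /(_ _ _ (ha n.+1 isT)).
have : 0 <= MY - Y n.+2 by rewrite subr_ge0 hY //= leqnn.
move=> /ler_wpM2r /(_ _ _ (hb n.+1 isT)); lra.
Qed.

(** If [S 1] bounds [S] up to [n], then [weighted_telescope] with bound [S 1]
gives [0 <= q n.+1 <= a n * (S 1 - S n.+1)], so that it bounds [S n.+1]. *)
Lemma potential_le_initial (th a S q : nat -> R) :
  (forall k, (1 <= k)%N -> 0 < th k <= 1) -> th 1%N = 1 ->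
  (forall k, (1 <= k)%N -> (1 - th k.+1) * a k <= a k.+1) ->
  (forall k, (1 <= k)%N -> 0 < a k) ->
  (forall k, (1 <= k)%N -> 0 <= q k.+1) ->
  (forall k, (1 <= k)%N -> q k.+1 <= (1 - th k) * q k + a k * (S k - S k.+1)) ->
  forall k, (1 <= k)%N -> S k <= S 1%N.
Proof.
move=> th01 th1 ha a0 q0 step; elim/ltn_ind => -[//|[//|n]] IH _.
suff le : q n.+2 <= a n.+1 * (S 1%N - S n.+2).
  by have := le_trans (q0 n.+1 isT) le; rewrite pmulr_rge0 ?a0 // subr_ge0.
have := @weighted_telescope th a (fun=> 0) S (fun=> 0) q (S 1%N) 0 n.+1
  th01 th1 ha.
rewrite mul0r addr0; apply=> // [k _|k k1|k k1|k /andP[k1 kn]].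
- by rewrite mulr0.
- by rewrite addr0 step.
- exact: ltW (a0 k k1).
- exact: IH.
Qed.

End Summation.

(** * The gap estimate *)

Theorem theorem3p2 (R : realType) (d r : nat)
    (f : 'cV[R]_d -> R) (g : 'cV[R]_r -> R) (B : 'M[R]_(r, d))
    (Lf Lg lambda : R) (theta gamma : nat -> R)
    (x xag : nat -> 'cV[R]_d) (y yag : nat -> 'cV[R]_r)
    (B1 : set 'cV[R]_d) (B2 : set 'cV[R]_r)
    (f_convex : @convex_function R 'cV[R]_d setT f)
    (f_diff : forall u, differentiable f u)
    (Lf_gt0 : 0 < Lf)
    (f_lip : forall u v,
      norm2 (gradient f u - gradient f v) <= Lf * norm2 (u - v))
    (g_convex : @convex_function R 'cV[R]_r setT g)
    (g_lip : forall u v, `|g u - g v| <= Lg * norm2 (u - v))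
    (B_neq0 : B != 0)
    (lambda_gt0 : 0 < lambda)
    (lambda_le : lambda <= 1 / rho_max (B *m B^T))
    (theta_itv : forall k, (1 <= k)%N -> 0 < theta k <= 1)
    (gamma_itv : forall k, (1 <= k)%N -> 0 < gamma k <= 1 / Lf)
    (gamma_ratio : forall k, (1 <= k)%N -> theta k.+1 < 1 ->
      gamma k.+1 / gamma k
        <= theta k.+1 ^+ 2 / (theta k ^+ 2 * (1 - theta k.+1)))
    (gamma_ratio_inv : forall k, (1 <= k)%N -> theta k.+1 < 1 ->
      gamma k / gamma k.+1 <= 1 / (1 - theta k.+1))
    (step_incr : forall k, (1 <= k)%N ->
      gamma k ^+ 2 / theta k ^+ 2 <= gamma k.+1 ^+ 2 / theta k.+1 ^+ 2)
    (step_bounded : exists C : R, forall k, (1 <= k)%N ->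
      gamma k ^+ 2 / theta k ^+ 2 <= C)
    (theta1 : theta 1%N = 1)
    (algo : APDFP f g B lambda theta gamma x xag y yag)
    (saddle_exists : exists zh, saddle_point f g B zh)
    (B2_dom : B2 `<=` edom (conjugate g))
    (B1_bounded : bounded_set B1)
    (B2_bounded : bounded_set B2)
    (saddle_in : exists2 zh, (B1 `*` B2) zh & saddle_point f g B zh) :
  exists Omega1 Omega2 : R,
    [/\ 0 <= Omega1, 0 <= Omega2 &
      forall k : nat, (1 <= k)%N ->
        (partial_gap f g B B1 B2 (xag k.+1) (yag k.+1)
         <= (theta k ^+ 2 / (2 * gamma k) * Omega1
             + gamma k / 2 * (rho_max (1%:M - lambda *: (B *m B^T)) / lambda)
               * Omega2)%:E)%E].
Proof.
have [xag1 yag1 iter] := algo.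
pose h y := fine (conjugate g y).
pose M := 1%:M - lambda *: (B *m B^T).
pose Y k u := dot (M *m (y k - u)) (y k - u).
pose X k u := dot (x k - u) (x k - u).
pose a k := theta k ^+ 2 / (2 * gamma k).
pose b k := gamma k / (2 * lambda).
pose q u v k := f (xag k) + dot (B *m xag k) v - h v
                - (f u + dot (B *m u) (yag k) - h (yag k)).
have Msym : M^T = M.
  by rewrite /M linearB /= linearZ /= trmx1 trmx_mul trmxK.
(* [rho_max (B B^T)] is positive since its inverse is at least [lambda]. *)
have Mpsd u : 0 <= dot (M *m u) u.
  have rho0 : 0 < rho_max (B *m B^T).
    by rewrite -invr_gt0 -div1r (lt_le_trans lambda_gt0).
  have := @quad_le_rho_max _ _ (B *m B^T) u.
  rewrite trmx_mul trmxK => /(_ erefl) le_rho.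
  have := ler_wpM2l (ltW lambda_gt0) le_rho.
  rewrite ler_pdivlMr // in lambda_le.
  have := ler_wpM2r (dot_sqr_ge0 u) lambda_le.
  by rewrite /M mulmxBl mul1mx -scalemxAl !dotLR; lra.
have rhoM0 : 0 <= rho_max M.
  have [i [j Bij]] := matrix0Pn B B_neq0.
  have u0 : delta_mx i 0 != 0 :> 'cV[R]_r.
    by apply/matrix0Pn; exists i, 0; rewrite mxE !eqxx oner_eq0.
  rewrite -(pmulr_lge0 _ (dot_sqr_gt0 u0)).
  exact: le_trans (Mpsd _) (quad_le_rho_max _ Msym).
have Y0 k u : 0 <= Y k u by exact: Mpsd.
have X0 k u : 0 <= X k u by exact: dot_sqr_ge0.
have theta0 k : (1 <= k)%N -> 0 < theta k by move=> /theta_itv/andP[].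
have gamma0 k : (1 <= k)%N -> 0 < gamma k by move=> /gamma_itv/andP[].
have a0 k : (1 <= k)%N -> 0 < a k.
  by move=> k1; rewrite divr_gt0 ?exprn_gt0 ?mulr_gt0 ?theta0 ?gamma0.
have b0 k : (1 <= k)%N -> 0 < b k.
  by move=> k1; rewrite divr_gt0 ?mulr_gt0 ?gamma0.
(* When [theta k.+1 = 1] the ratio conditions say nothing, but both growth
   conditions are then trivial. *)
have a_growth k : (1 <= k)%N -> (1 - theta k.+1) * a k <= a k.+1.
  move=> k1; have /andP[_] := theta_itv k.+1 isT.
  rewrite le_eqVlt => /predU1P[->|th1].
    by rewrite subrr mul0r (ltW (a0 k.+1 _)).
  have th1' : 0 < 1 - theta k.+1 by lra.
  have := gamma_ratio k k1 th1.
  rewrite ler_pdivlMr ?mulr_gt0 ?exprn_gt0 ?theta0 // => le.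
  rewrite ler_pdivlMr ?mulr_gt0 ?gamma0 //; apply: le_trans le.
  rewrite /a (_ : _ * (2 * _) =
    gamma k.+1 / gamma k * (theta k ^+ 2 * (1 - theta k.+1))) //.
  by field; rewrite gt_eqF ?gamma0.
have b_growth k : (1 <= k)%N -> (1 - theta k.+1) * b k <= b k.+1.
  move=> k1; have /andP[_] := theta_itv k.+1 isT.
  rewrite le_eqVlt => /predU1P[->|th1].
    by rewrite subrr mul0r (ltW (b0 k.+1 _)).
  have th1' : 0 < 1 - theta k.+1 by lra.
  have := gamma_ratio_inv k k1 th1.
  rewrite ler_pdivlMr // mulrAC ler_pdivrMr ?gamma0 // mul1r mulrC => le.
  by rewrite mulrA ler_pM2r // invr_gt0 mulr_gt0.
have [[xh yh] [/= B1xh B2yh] [/= yhdom saddle]] := saddle_in.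
have ydom k : (1 <= k)%N -> edom (conjugate g) (y k.+1).
  move=> k1; have [/set_mem prox _ _ _] := iter k k1.
  have c0 : 0 < lambda * theta k / gamma k.
    by rewrite divr_gt0 ?mulr_gt0 ?theta0 ?gamma0.
  by have [] := prox_conjugate c0 prox yhdom.
(* [y 1] need not lie in the domain of the conjugate; as [theta 1 = 1], the
   average [yag 2] does not see it. *)
have yag_conv k : (1 <= k)%N -> edom (conjugate g) (yag k.+1) /\
    h (yag k.+1) <= (1 - theta k) * h (yag k) + theta k * h (y k.+1).
  case: k => // k _; elim: k => [|k [IH _]].
    have [_ _ _ ->] := iter 1%N isT; rewrite theta1 subrr scale0r add0r scale1r.
    by rewrite mul0r add0r mul1r; split => //; exact: ydom.
  have [_ _ _ ->] := iter k.+2 isT.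
  apply: conjugate_convex => //; first exact: ydom.
  by have /andP[/ltW-> ->] := theta_itv k.+2 isT.
have step u v k : edom (conjugate g) v -> (1 <= k)%N ->
    q u v k.+1 <= (1 - theta k) * q u v k
      + a k * (X k u - X k.+1 u) + b k * (Y k v - Y k.+1 v).
  move=> vdom k1; have [prox xE xagE yagE] := iter k k1.
  have [_ hy] := yag_conv k k1.
  have := accelerated_gradient_step u f_convex f_diff f_lip Lf_gt0
    (theta_itv k k1) (gamma_itv k k1) xE.
  have cE : lambda * theta k / gamma k = lambda / (gamma k / theta k).
    by rewrite invf_div mulrA.
  have ga_th : 0 < gamma k / theta k by rewrite divr_gt0 ?theta0 ?gamma0.
  have := dual_step lambda_gt0 ga_th cE Mpsd prox xE vdom.
  move=> /(ler_wpM2l (ltW (theta0 _ k1))).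
  rewrite -/(Y k v) -/(Y k.+1 v) -/(h _) -/(h v) -xagE -/(a k).
  rewrite -/(X k u) -/(X k.+1 u) => hd hp.
  have bE : theta k * (gamma k / theta k / (2 * lambda)) = b k.
    by rewrite /b; field; rewrite !gt_eqF ?theta0.
  rewrite mulrDr (mulrDr _ (h v)) mulrA bE in hd.
  have xagB : dot (B *m xag k.+1) v =
      (1 - theta k) * dot (B *m xag k) v + theta k * dot (B *m x k.+1) v.
    by rewrite xagE mulmxDr -!scalemxAr !dotLR.
  have yagB : dot (B *m u) (yag k.+1) =
      (1 - theta k) * dot (B *m u) (yag k) + theta k * dot (B *m u) (y k.+1).
    by rewrite yagE !dotLR.
  rewrite -dot_mulmxl mulmxBr dotDl dotNl in hp.
  rewrite dotDr dotNr in hd.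
  rewrite /q xagB yagB; lra.
have norm_dom v : edom (conjugate g) v -> dot v v <= Lg ^+ 2.
  by apply: edom_conjugate_bounded.
(* [DY] bounds [dot (y k - v) (y k - v)] for [v] in the domain; [y 1] enters
   separately, being arbitrary. *)
pose DY := 2 * (dot (y 1%N) (y 1%N) + Lg ^+ 2) + 2 * Lg ^+ 2.
have y_bound k v : (1 <= k)%N -> edom (conjugate g) v ->
    Y k v <= rho_max M * DY.
  move=> k1 /norm_dom hv; apply: le_trans (quad_le_rho_max _ Msym) _.
  apply: ler_wpM2l => //; apply: le_trans (dot_sqrB_le _ 0 _) _.
  rewrite subr0 sub0r dotNl dotNr opprK /DY.
  have Lg0 := sqr_ge0 Lg; have y10 := dot_sqr_ge0 (y 1%N).
  suff : dot (y k) (y k) <= dot (y 1%N) (y 1%N) + Lg ^+ 2 by lra.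
  case: k k1 => [//|[|k]] _; first by lra.
  by have := norm_dom _ (ydom k.+1 isT); lra.
pose t k := gamma k ^+ 2 / theta k ^+ 2 / lambda.
have abt k : (1 <= k)%N -> b k = a k * t k.
  move=> k1; rewrite /a /b /t; field.
  by rewrite !gt_eqF ?theta0 ?gamma0.
have t_incr k : (1 <= k)%N -> t k <= t k.+1.
  by move=> k1; rewrite ler_pM2r ?invr_gt0 // step_incr.
have [C hC] := step_bounded.
pose S k := X k xh + t k * (Y k yh - rho_max M * DY).
have saddle_gap k : (1 <= k)%N -> 0 <= q xh yh k.+1.
  move=> k1; have [yagdom _] := yag_conv k k1.
  have := saddle (xag k.+1, yag k.+1) yagdom.
  rewrite /Q /= -(fineK (conjugate_fin_num yagdom)).
  rewrite -(fineK (conjugate_fin_num yhdom)).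
  by rewrite -!EFinB lee_fin /q -/(h _) -/(h yh); lra.
have S_step k : (1 <= k)%N -> q xh yh k.+1 <= (1 - theta k) * q xh yh k
    + a k * (S k - S k.+1).
  move=> k1; apply: le_trans (step xh yh k yhdom k1) _.
  have incr0 : 0 <= a k * ((t k.+1 - t k) * (rho_max M * DY - Y k.+1 yh)).
    by rewrite mulr_ge0 ?(ltW (a0 _ _)) // mulr_ge0 ?subr_ge0 ?t_incr ?y_bound.
  by rewrite abt // /S; lra.
have S_le k : (1 <= k)%N -> S k <= S 1%N.
  exact: (potential_le_initial theta_itv theta1 a_growth a0 saddle_gap S_step).
pose KX := S 1%N + C / lambda * (rho_max M * DY).
have x_bound k : (1 <= k)%N -> X k xh <= KX.
  move=> k1; have := S_le k k1.
  have Y_le := y_bound 1%N yh isT yhdom.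
  have D0 : 0 <= rho_max M * DY by exact: le_trans (Y0 _ _) Y_le.
  have t0 : 0 <= t k.
    by rewrite !divr_ge0 ?exprn_ge0 // ltW ?theta0 ?gamma0.
  have tC : t k <= C / lambda by rewrite ler_pM2r ?invr_gt0 // hC.
  have := ler_wpM2r D0 tC; have := mulr_ge0 t0 (Y0 k yh).
  by rewrite /KX {1}/S; lra.
have [K hK] : exists K, forall u, B1 u -> dot u u <= K.
  have [N [_ hN]] := B1_bounded; exists (d%:R * (N + 1) ^+ 2) => u B1u.
  apply: le_trans (dot_sqr_le_normr _) _; apply: ler_wpM2l => //.
  have : `|u| <= N + 1 by apply: hN => //; rewrite ltrDl.
  move=> le; rewrite ler_sqr ?nnegrE ?normr_ge0 //.
  exact: le_trans (normr_ge0 _) le.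
have KX0 : 0 <= KX by exact: le_trans (X0 1%N xh) (x_bound 1%N isT).
have K0 : 0 <= K by exact: le_trans (dot_sqr_ge0 xh) (hK _ B1xh).
have DY0 : 0 <= DY.
  by have := sqr_ge0 Lg; have := dot_sqr_ge0 (y 1%N); rewrite /DY; lra.
exists (2 * KX + 2 * (2 * K + 2 * K)), DY; split => [||k k1]; [lra|by []|].
apply: ge_ereal_sup => _ [[u v] [/= B1u B2v] <-].
have vdom := B2_dom _ B2v; have [yagdom _] := yag_conv k k1.
have -> : Q f g B (xag k.+1, yag k.+1) (u, v) = (q u v k.+1)%:E.
  rewrite /Q /= -(fineK (conjugate_fin_num yagdom)).
  rewrite -(fineK (conjugate_fin_num vdom)).
  by rewrite -!EFinB.
rewrite lee_fin.
set O1 := 2 * KX + _.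
have X_le j : (1 <= j)%N -> X j u <= O1.
  move=> j1; apply: le_trans (dot_sqrB_le _ xh _) _.
  have := dot_sqrB_le xh 0 u; have := hK _ B1u; have := hK _ B1xh.
  have := x_bound j j1.
  by rewrite subr0 sub0r dotNl dotNr opprK /X /O1; lra.
have := @weighted_telescope R theta a b (X^~ u) (Y^~ v) (q u v) O1
  (rho_max M * DY) k theta_itv theta1 a_growth b_growth
  (fun j => step u v j vdom).
move=> /(_ (fun j hj => ltW (a0 j hj)) (fun j hj => ltW (b0 j hj)) _ _ k1) tele.
apply: le_trans (tele _ _) _ => [j /andP[/X_le]|j /andP[j1 _]|] //.
  exact: y_bound.
have -> : gamma k / 2 * (rho_max M / lambda) * DY = b k * (rho_max M * DY).
  by rewrite /b; field; rewrite gt_eqF.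
have := mulr_ge0 (ltW (a0 k k1)) (X0 k.+1 u).
have := mulr_ge0 (ltW (b0 k k1)) (Y0 k.+1 v).
rewrite -/(a k); lra.
Qed.
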